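(* Let $(\Omega,d)$ be a complete metric space equipped with an average $A_\omega$, and let $\mathcal{S}^{\mathcal{L}}=\{S_j^{L_j}\}_{j\ge0}$ be a non-stationary subdivision scheme on $\Omega$ with common invariant domain $\mathcal{D}^\ast$, refinement factors $\mu_j^{(L_j)}$ and block displacement-safe constants $C_{S_j}^{(L_j)}$. Assume: 1. There exist $L^\ast\in\mathbb{N}$ and $C^\ast,\mu^\ast\in[0,\infty)$ such that $L_j\le L^\ast$, $C_{S_j}^{(L_j)}\le C^\ast$ and $\mu_j^{(L_j)}\le\mu^\ast$ for all $j\ge0$. 2. The sequence of products of refinement factors is summable: $$\sum_{k=0}^\infty\ \prod_{j=0}^k\mu_j^{(L_j)}<\infty.$$ Then, for every initial data $P^0\in\mathcal{D}^\ast$, the sequence of piecewise average interpolants $\bigl\{\mathcal{PA}(A_\omega,Q^{[k]};t)\bigr\}_{k\ge0}$, where $$Q^{[k]}=\bigl(T^{N_k},\,S_k^{L_k}S_{k-1}^{L_{k-1}}\cdots S_1^{L_1}S_0^{L_0}(P^0)\bigr),\qquad N_k=\sum_{\nu=0}^kL_\nu,\qquad T^{N}=2^{-N}\mathbb{Z},$$ converges uniformly in $t\in\mathbb{R}$ to a continuous limit $Q^\infty:\mathbb{R}\to\Omega$.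
   Context: **Average.** An average on $(\Omega,d)$ is a family of maps $A_\omega:\Omega\times\Omega\to\Omega$, $\omega\in[0,1]$, such that for all $x,y\in\Omega$: (i) $\omega\mapsto A_\omega(x,y)$ is continuous on $[0,1]$; (ii) $A_0(x,y)=x$, $A_1(x,y)=y$; (iii) $A_\omega(x,x)=x$; (iv) $A_\omega(x,y)=A_{1-\omega}(y,x)$; (v) $\max\{d(x,A_\omega(x,y)),d(y,A_\omega(x,y))\}\le d(x,y)$. **Piecewise average interpolant.** For $Q=\{(t_j,p_j)\}_{j\in\mathbb{Z}}$ with $t_j<t_{j+1}$: $\mathcal{PA}(A_\omega,Q;t)=A_{\omega}(p_j,p_{j+1})$ with $\omega=\frac{t-t_j}{t_{j+1}-t_j}$ for $t\in[t_j,t_{j+1}]$. Primal parameters are used: in $Q=(T^N,P)$ the point $P_j$ is associated with $t_j^N=j2^{-N}$. $\delta(P)=\sup_{j\in\mathbb{Z}}d(P_j,P_{j+1})$. **Refinement operator.** A (binary) refinement operator $S$ maps sequences to sequences and is local: there is $M_S\in\mathbb{N}$ such that $S(P)_{2j}$ and $S(P)_{2j+1}$ do not depend on $P_\ell$ for $\ell<j-M_S$ or $\ell>j+M_S$. **Admissible operator.** Let $S$ be a refinement operator defined on sequences in $\mathcal{D}\subset\{P\in\Omega^{\mathbb{Z}}:\delta(P)<\infty\}$. $S$ is admissible relative to refinement level $L\in\mathbb{N}$ if $S^m(\mathcal{D})\subset\mathcal{D}$ for $m=1,\ldots,L$, if $$\mu^{(L)}=\sup_{P\in\mathcal{D},\,\delta(P)>0}\frac{\delta(S^L(P))}{\delta(P)}<\infty,$$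 and if there is a constant $C_S^{(L)}<\infty$ such that $$\sup_{i\in\mathbb{Z}}d\bigl((S^L(P))_{2^Li},P_i\bigr)\le C_S^{(L)}\,\delta(P),\qquad P\in\mathcal{D}.$$ $\mu^{(L)}$ is the refinement factor of $S$ associated with refinement level $L$, and $C_S^{(L)}$ is the displacement-safe constant of the block $S^L$. **Non-stationary subdivision scheme.** It is given by a sequence $\{S_j\}_{j\ge0}$ of refinement operators, with domains $\mathcal{D}_j$, and a sequence of refinement levels $\{L_j\}_{j\ge0}\subset\mathbb{N}$ such that $S_j$ is admissible relative to $L_j$ (with refinement factor $\mu_j^{(L_j)}$ and block displacement-safe constant $C_{S_j}^{(L_j)}$), and such that $\mathcal{D}^\ast=\bigcap_{j\ge0}\mathcal{D}_j$ is nonempty and $S_j^m(\mathcal{D}^\ast)\subset\mathcal{D}^\ast$ for $m=1,\ldots,L_j$, $j\ge0$. The process applies successively the blocks $S_0^{L_0},S_1^{L_1},S_2^{L_2},\ldots$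
   Formalization: The formal theorem adds the assumption that each block S_j^{L_j} maps every P in D* with δ(P)=0 to a sequence with δ=0; without it the claim fails, since the refinement factor is a supremum only over P with δ(P)>0. *)

(* Defs.v *)
From HB Require Import structures.
From mathcomp Require Import all_boot all_order all_algebra.
From mathcomp Require Import all_classical all_reals all_analysis.

Set Implicit Arguments.
Unset Strict Implicit.
Unset Printing Implicit Defensive.

Import Order.TTheory GRing.Theory Num.Theory.
Import numFieldNormedType.Exports.

Local Open Scope classical_set_scope.
Local Open Scope ring_scope.

#[short(type="completeMetricType")]
HB.structure Definition CompleteMetric (K : numDomainType) :=
  {T of Metric K T & Complete T}.

(* Only the values for weights w in [0, 1] matter: a family indexed by [0, 1]
   is represented by a total function of w : R. *)
Record is_average (R : realType) (Omega : metricType R)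
    (A : R -> Omega -> Omega -> Omega) : Prop := IsAverage {
  average_continuous : forall x y,
    {within `[0, 1], continuous (fun w : R => A w x y)} ;
  average_0 : forall x y, A 0 x y = x ;
  average_1 : forall x y, A 1 x y = y ;
  average_diag : forall w x, 0 <= w <= 1 -> A w x x = x ;
  average_sym : forall w x y, 0 <= w <= 1 -> A w x y = A (1 - w) y x ;
  average_bound : forall w x y, 0 <= w <= 1 ->
    Num.max (mdist x (A w x y)) (mdist y (A w x y)) <= mdist x y }.

(* On the half-open cells [t_j, t_(j+1)) the index j is unique; the values on
   the closed cells are given by piecewise_averageE below. The index is 0 for
   an s outside all cells, which does not occur for the grids 2^-N Z. *)
Definition piecewise_average (R : realType) (Omega : Type)
    (A : R -> Omega -> Omega -> Omega) (t : int -> R) (p : int -> Omega)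
    (s : R) : Omega :=
  let j := xget (0 : int) [set j | t j <= s < t (j + 1)] in
  A ((s - t j) / (t (j + 1) - t j)) (p j) (p (j + 1)).

Lemma piecewise_averageE (R : realType) (Omega : metricType R)
    (A : R -> Omega -> Omega -> Omega) (t : int -> R) (p : int -> Omega)
    (j : int) (s : R) :
  is_average A -> {homo t : i k / i < k} -> t j <= s <= t (j + 1) ->
  piecewise_average A t p s
    = A ((s - t j) / (t (j + 1) - t j)) (p j) (p (j + 1)).
Proof.
move=> hA ht /andP[js sj].
have cellP i k : t i <= s < t (i + 1) -> t k <= s < t (k + 1) -> i = k.
  have aux a b : t a <= s -> s < t (b + 1) -> a <= b.
    move=> h1 h2; rewrite leNgt; apply/negP => ba.
    have : t (b + 1) <= t a.
      move: ba; rewrite -lezD1 le_eqVlt => /predU1P[->//|/ht/ltW//].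
    by move=> h; have := le_lt_trans (le_trans h h1) h2; rewrite ltxx.
  move=> /andP[i1 i2] /andP[k1 k2]; apply/le_anti.
  by rewrite !aux.
have cellE i : t i <= s < t (i + 1) ->
    xget (0 : int) [set j | t j <= s < t (j + 1)] = i.
  by move=> hi; case: xgetP => [k _ /= hk|/(_ i)/=]; [exact: cellP|].
rewrite /piecewise_average; move: sj; rewrite le_eqVlt => /predU1P[sE|sj].
  rewrite (cellE (j + 1)) ?sE ?lexx ?ht ?ltrDl// subrr mul0r divff.
    by rewrite (average_0 hA) (average_1 hA).
  by rewrite subr_eq0 gt_eqF// ht// ltrDl.
by rewrite (cellE j) ?js.
Qed.

Definition primal_grid (R : realType) (N : nat) (j : int) : R :=
  j%:~R * 2 ^- N.

Section Refinement.
Context (R : realType) (Omega : metricType R).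
Implicit Types (P : int -> Omega) (S : (int -> Omega) -> (int -> Omega))
  (D : set (int -> Omega)) (L m : nat).

Definition delta P : \bar R :=
  ereal_sup (range (fun j : int => (mdist (P j) (P (j + 1)))%:E)).

(* An operator defined on D is a total function whose values outside D are
   irrelevant, hence the restriction of locality to sequences in D. *)
Definition refinement_operator S D : Prop :=
  exists M : nat, forall P P', D P -> D P' -> forall j : int,
    (forall l : int, j - M%:Z <= l <= j + M%:Z -> P l = P' l) ->
    S P (2 * j) = S P' (2 * j) /\ S P (2 * j + 1) = S P' (2 * j + 1).

Definition invariant_upto S D L : Prop :=
  forall m, (1 <= m <= L)%N -> iter m S @` D `<=` D.

(* The supremum is taken in [0, +oo]: adjoining 0 only makes it equal to 0,
   instead of -oo, when no P in D has delta P > 0. *)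
Definition refinement_factor S D L : \bar R :=
  ereal_sup ([set 0%E] `|`
    [set (delta (iter L S P) / delta P)%E
      | P in [set P | D P /\ (0 < delta P)%E]]).

Definition displacement_safe S D L (C : R) : Prop :=
  forall P, D P ->
    (ereal_sup (range (fun i : int =>
       (mdist (iter L S P (2 ^+ L * i)) (P i))%:E)) <= C%:E * delta P)%E.

Record admissible S D L : Prop := Admissible {
  admissible_operator : refinement_operator S D ;
  admissible_domain : D `<=` [set P | (delta P < +oo)%E] ;
  admissible_invariant : invariant_upto S D L ;
  admissible_factor : (refinement_factor S D L < +oo)%E ;
  admissible_displacement : exists C : R, displacement_safe S D L C }.

Definition common_domain (D : nat -> set (int -> Omega)) :
  set (int -> Omega) := \bigcap_j D j.

(* The displacement-safe constants are not determined by the operators, so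
   that a choice C of them is part of the data. *)
Record nonstationary_scheme (S : nat -> (int -> Omega) -> (int -> Omega))
    (D : nat -> set (int -> Omega)) (L : nat -> nat) (C : nat -> R) : Prop :=
  NonstationaryScheme {
  scheme_admissible : forall j, admissible (S j) (D j) (L j) ;
  scheme_displacement : forall j, displacement_safe (S j) (D j) (L j) (C j) ;
  scheme_common_domain : common_domain D !=set0 ;
  scheme_invariant : forall j, invariant_upto (S j) (common_domain D) (L j) }.

Fixpoint refined (S : nat -> (int -> Omega) -> (int -> Omega))
    (L : nat -> nat) (P0 : int -> Omega) (k : nat) : int -> Omega :=
  iter (L k) (S k) (if k is k'.+1 then refined S L P0 k' else P0).

End Refinement.

(* Main.v *)
Require Import Defs.
From HB Require Import structures.
From mathcomp Require Import all_boot all_order all_algebra.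
From mathcomp Require Import all_classical all_reals all_analysis.
From mathcomp Require Import lra.

(** The interpolants are uniformly Cauchy, because consecutive ones differ by a
    term of a convergent series. Let P^k be the data after block k, F_k its
    interpolant and d_k its variation delta(P^k).

    Write l for the level of block k + 1, and L, C, mu for the uniform bounds on
    levels, displacement constants and refinement factors. Over a cell of the
    coarse grid that starts at P^k_i, the interpolant F_k stays within d_k of
    P^k_i, by the bound on averages. The finer grid starts that cell with the
    point of index 2^l i of P^(k+1), which is within C d_k of P^k_i. Over the
    2^l finer cells in between, F_(k+1) walks along at most 2^l edges of length
    at most d_(k+1) <= mu d_k. Hence
      d(F_k(t), F_(k+1)(t)) <= (1 + C + 2^L mu) d_k
    for all t [mdist_piecewise_average_refine].

    Applying the refinement factors one after the other gives
    d_k <= (mu_0 ... mu_k) delta(P^0) [delta_refined_le], so summability of the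
    products makes the d_k summable. Completeness then yields a uniform limit
    [uniform_cvg_summable_steps]. Each interpolant is continuous, being pasted
    from continuous averages on adjacent closed cells
    [piecewise_average_continuous], and uniform limits of continuous functions
    are continuous. *)

Set Implicit Arguments.
Unset Strict Implicit.
Unset Printing Implicit Defensive.

Import Order.TTheory GRing.Theory Num.Theory.
Import numFieldNormedType.Exports.

Local Open Scope classical_set_scope.
Local Open Scope ring_scope.

(** * Uniform convergence from summable steps *)

Section UniformLimit.
Context (R : realType).

Lemma mdist_le_series (V : metricType R) (x : nat -> V) (e : nat -> R) :
  (forall n, mdist (x n) (x n.+1) <= e n) ->
  forall m n, (m <= n)%N -> mdist (x m) (x n) <= series e n - series e m.
Proof.
move=> xe m n /subnK <-; elim: (n - m)%N => [|k IH].
  by rewrite add0n mdistxx subrr.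
rewrite addSn (le_trans (metric_triangle _ (x (k + m)%N) _))//.
rewrite [series e (k + m).+1]seriesSr.
by have := xe (k + m)%N; move: IH; lra.
Qed.

(** The partial sums of e are Cauchy, and they control the distance between
    any two terms of u at all points simultaneously; so u is Cauchy for the
    uniform structure on functions, which is complete because V is. *)
Lemma uniform_cvg_summable_steps (T : choiceType) (V : completeMetricType R)
  (u : nat -> T -> V) (e : nat -> R) :
  (forall n t, mdist (u n t) (u n.+1 t) <= e n) -> cvgn (series e) ->
  exists f : T -> V, {uniform, u @ \oo --> f}.
Proof.
move=> ue /cvg_cauchy/cauchy_ballP ce.
suff : cvg (u @ \oo : set_system (arrow_uniform_type T V)).
  by move=> /cvg_ex[f uf]; exists f; rewrite uniform_nbhsT.
apply: fun_complete; apply/cauchy_exP => eps eps0.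
have /nearP_dep := ce eps eps0 => -[N _ Ne].
exists (u N); have [M _ NM] := Ne N (leqnn N).
exists (maxn N M) => // n /=; rewrite geq_max => /andP[Nn Mn] t.
rewrite ballEmdist/=.
have := mdist_le_series (fun k => ue k t) Nn => /le_lt_trans; apply.
have := NM n Mn; rewrite -ball_normE/= distrC.
exact/le_lt_trans/ler_norm.
Qed.

End UniformLimit.

(** * Piecewise averages *)

Section PiecewiseAverage.
Context (R : realType) (Omega : metricType R).
Context (A : R -> Omega -> Omega -> Omega) (hA : is_average A).
Implicit Types (t : int -> R) (p : int -> Omega) (s : R).

Lemma cell_weight t j s : {homo t : i k / i < k} -> t j <= s <= t (j + 1) ->
  0 <= (s - t j) / (t (j + 1) - t j) <= 1.
Proof.
move=> ht /andP[js sj].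
have tj : 0 < t (j + 1) - t j by rewrite subr_gt0 ht// ltrDl.
apply/andP; split; first by rewrite divr_ge0 ?(ltW tj)// subr_ge0.
by rewrite ler_pdivrMr// mul1r lerB.
Qed.

Lemma mdist_piecewise_average t p j s :
  {homo t : i k / i < k} -> t j <= s <= t (j + 1) ->
  mdist (p j) (piecewise_average A t p s) <= mdist (p j) (p (j + 1)).
Proof.
move=> ht sj; rewrite (piecewise_averageE p hA ht sj).
have := average_bound hA (p j) (p (j + 1)) (cell_weight ht sj).
by rewrite ge_max => /andP[].
Qed.

(** On a closed cell the interpolant is the average of two fixed points composed
    with the affine map of the cell onto [0, 1]. *)
Lemma piecewise_average_cell_continuous t p j : {homo t : i k / i < k} ->
  {within `[t j, t (j + 1)], continuous (piecewise_average A t p)}.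
Proof.
move=> ht; set I := `[_, _]%classic.
have inI s : I s -> t j <= s <= t (j + 1) by rewrite /I/= in_itv.
pose w s := (s - t j) / (t (j + 1) - t j).
apply: (@subspace_eq_continuous _ I _
  (from_subspace I (fun s => A (w s) (p j) (p (j + 1)) : Omega))).
  move=> s /set_mem/inI sj.
  by rewrite /from_subspace (piecewise_averageE p hA ht sj).
apply/(@subspace_continuousP _ I) => s Is.
have /(@subspace_continuousP _ (`[0, 1]%classic : set R)) cA :=
  @average_continuous _ _ _ hA (p j) (p (j + 1)).
have w01 x : I x -> w x \in `[0, 1] by move=> /inI/(cell_weight ht).
(* The average is continuous only within [0, 1], so the affine map has to tend
   to w s within [0, 1], not merely in R. *)
have cw :
    w x @[x --> within I (nbhs s)] --> within `[0, 1]%classic (nbhs (w s)).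
  have cw : continuous w.
    move=> x; apply: cvgM; last exact: cvg_cst.
    by apply: cvgB; [exact: cvg_id|exact: cvg_cst].
  move=> B nB; change (nbhs s (fun x : R => I x -> B (w x))).
  have := cw s _ nB.
  by apply: (@filterS _ _ (nbhs_filter (s : R))) => x /= Bx /w01 /Bx.
have {}cA := cA _ (w01 _ Is); rewrite /from_subspace in cA *.
have := cvg_app (fun y => A y (p j) (p (j + 1)) : Omega) cw.
by move=> /cvg_trans; apply; exact: cA.
Qed.

(** A point of the half-open cell [t_j, t_(j+1)) is interior to the union of the
    closed cells j - 1 and j, on which the two continuous pieces are pasted. *)
Lemma piecewise_average_continuous t p : {homo t : i k / i < k} ->
  (forall s, exists j, t j <= s < t (j + 1)) ->
  continuous (piecewise_average A t p).
Proof.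
move=> ht cover s; have [j /andP[js sj]] := cover s.
have ltj : t (j - 1) < t j by apply: ht; rewrite ltrBlDr ltrDl.
have := @piecewise_average_cell_continuous t p (j - 1) ht.
rewrite subrK => cl.
have := withinU_continuous (@itv_closed _ R _ _) (@itv_closed _ R _ _) cl
  (@piecewise_average_cell_continuous t p j ht).
set J := (X in {within X, continuous _}) => cJ.
have Js : nbhs s J.
  exists (Num.min (s - t (j - 1)) (t (j + 1) - s)) => /=.
    by rewrite lt_min !subr_gt0 sj (lt_le_trans ltj).
  move=> x /=; rewrite lt_min /J /= !in_itv /=.
  rewrite ltr_norml ltr_norml => /andP[/andP[_ h1] /andP[h2 _]].
  have [xj|jx] := leP x (t j); [left|right]; apply/andP; split=> //.
  - by lra.
  - exact: ltW.
  - by lra.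
have Jss : J s by exact: nbhs_singleton.
move/(@subspace_continuousP _ J) : cJ => /(_ s Jss).
by rewrite /from_subspace/= (within_interior Js).
Qed.

End PiecewiseAverage.

(** * Nested dyadic grids *)

Section PrimalGrid.
Context (R : realType).
Implicit Types (N : nat) (i j : int) (s : R).

Lemma ltr_primal_grid N i j : (primal_grid R N i < primal_grid R N j) = (i < j).
Proof. by rewrite /primal_grid ltr_pM2r ?ltr_int// invr_gt0 exprn_gt0. Qed.

Lemma primal_grid_refine N L i :
  primal_grid R (N + L) (2 ^+ L * i) = primal_grid R N i.
Proof.
rewrite /primal_grid addnC exprD invfM intrM rmorphXn/= mulrACA.
by rewrite divff ?mul1r// expf_neq0.
Qed.

Lemma primal_grid_cell N s :
  exists j, primal_grid R N j <= s < primal_grid R N (j + 1).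
Proof.
have N0 : (0 : R) < 2 ^+ N by rewrite exprn_gt0.
exists (Num.floor (s * 2 ^+ N)); rewrite /primal_grid.
by rewrite ler_pdivrMr// ltr_pdivlMr// floor_itv.
Qed.

End PrimalGrid.

(** * Distance between consecutive interpolants *)

Section StepEstimate.
Context (R : realType) (Omega : metricType R).
Context (A : R -> Omega -> Omega -> Omega) (hA : is_average A).
Implicit Types (p q : int -> Omega).

Lemma mdist_chain p (d : R) i n : (forall j, mdist (p j) (p (j + 1)) <= d) ->
  mdist (p i) (p (i + n%:Z)) <= n%:R * d.
Proof.
move=> pd; elim: n => [|n IH]; first by rewrite addr0 mdistxx mul0r.
rewrite (le_trans (metric_triangle _ (p (i + n%:Z)) _))//.
by rewrite -natr1 mulrDl mul1r lerD// -addn1 PoszD addrA.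
Qed.

(** Compare both interpolants with the values attached to the left end i 2^-N of
    the coarse cell around s: the three terms bound the coarse interpolant
    against p_i, then p_i against q at 2^L i, and then q at 2^L i against the
    fine interpolant. *)
Lemma mdist_piecewise_average_refine p q N L (d c d' : R) (s : R) :
  (forall j, mdist (p j) (p (j + 1)) <= d) ->
  (forall j, mdist (q j) (q (j + 1)) <= d') ->
  (forall i, mdist (q (2 ^+ L * i)) (p i) <= c) ->
  mdist (piecewise_average A (primal_grid R N) p s)
        (piecewise_average A (primal_grid R (N + L)) q s)
    <= d + c + 2 ^+ L * d'.
Proof.
move=> pd qd qp.
have hom M : {homo primal_grid R M : i j / i < j}.
  by move=> i j; rewrite ltr_primal_grid.
have [i /andP[i1 i2]] := primal_grid_cell N s.
have [l /andP[l1 l2]] := primal_grid_cell (N + L) s.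
(* The fine cell l lies inside the coarse cell i, so l is 2^L i + r, r < 2^L. *)
have il : 2 ^+ L * i <= l.
  rewrite -ltzD1 -(ltr_primal_grid R (N + L)) primal_grid_refine.
  exact: le_lt_trans l2.
have li : l < 2 ^+ L * i + 2 ^+ L.
  rewrite -[X in _ + X]mulr1 -mulrDr -(ltr_primal_grid R (N + L)).
  by rewrite primal_grid_refine; exact: le_lt_trans i2.
have [r rE] : exists r : nat, l = 2 ^+ L * i + r%:Z.
  by exists `|(l - 2 ^+ L * i)%R|%N; rewrite gez0_abs ?subr_ge0// addrC subrK.
have rL : (r%:R + 1 <= 2 ^+ L :> R).
  move: li; rewrite rE ltrD2l -natz -natrX ltr_nat => rL.
  by rewrite natr1 -natrX ler_nat.
have d'0 : 0 <= d' by exact: le_trans (mdist_ge0 _ _) (qd 0).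
have hp : mdist (piecewise_average A (primal_grid R N) p s) (p i) <= d.
  rewrite metric_sym (le_trans _ (pd i))//.
  by rewrite mdist_piecewise_average// i1 ltW.
have hq : mdist (q l) (piecewise_average A (primal_grid R (N + L)) q s) <= d'.
  by rewrite (le_trans _ (qd l))// mdist_piecewise_average// l1 ltW.
have hc : mdist (p i) (q (2 ^+ L * i)) <= c by rewrite metric_sym.
have hr := mdist_chain (2 ^+ L * i) r qd; rewrite -rE in hr.
apply: (le_trans (metric_triangle _ (p i) _)); rewrite -addrA.
apply: lerD => //.
apply: (le_trans (metric_triangle _ (q (2 ^+ L * i)) _)); apply: lerD => //.
apply: (le_trans (metric_triangle _ (q l) _)).
(* r edges from q at 2^L i to q_l, and one more for the fine cell itself. *)
by apply: le_trans (ler_wpM2r d'0 rL); rewrite mulrDl mul1r lerD.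
Qed.

End StepEstimate.

(** * Decay of the variation *)

Section Variation.
Context (R : realType) (Omega : metricType R).
Implicit Types (P : int -> Omega) (S : (int -> Omega) -> (int -> Omega))
  (D : set (int -> Omega)).

Lemma mdist_le_delta P j : ((mdist (P j) (P (j + 1)))%:E <= delta P)%E.
Proof. by apply: ereal_sup_ubound; exists j. Qed.

Lemma delta_ge0 P : (0 <= delta P)%E.
Proof. by apply: le_trans (mdist_le_delta P 0); rewrite lee_fin mdist_ge0. Qed.

Lemma delta_fin_num P : (delta P < +oo)%E -> delta P \is a fin_num.
Proof. by rewrite ge0_fin_numE ?delta_ge0. Qed.

Lemma refinement_factor_ge0 S D L : (0 <= refinement_factor S D L)%E.
Proof. by apply: ereal_sup_ubound; left. Qed.

(** For delta P > 0 this is the definition of the refinement factor as a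
    supremum of quotients; the hypothesis on delta P = 0 covers the sequences
    that this supremum leaves out. *)
Lemma delta_iter_le S D L P : D P -> (delta P < +oo)%E ->
  (delta P = 0 -> delta (iter L S P) = 0)%E ->
  (delta (iter L S P) <= refinement_factor S D L * delta P)%E.
Proof.
move=> DP Pfin; case: (eqVneq (delta P) 0%E) => [P0 /(_ P0)->|Pn0 _].
  by rewrite mule_ge0 ?delta_ge0 ?refinement_factor_ge0.
have Pgt0 : (0 < delta P)%E by rewrite lt0e Pn0 delta_ge0.
have Pf0 : 0 < fine (delta P) by rewrite fine_gt0 ?Pgt0.
have : (delta (iter L S P) / delta P <= refinement_factor S D L)%E.
  by apply: ereal_sup_ubound; right; exists P.
by rewrite -(fineK (delta_fin_num Pfin)) inver gt_eqF// lee_pdivrMr.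
Qed.

Lemma displacement_safe_mdist S D L (C : R) P i :
  displacement_safe S D L C -> D P ->
  ((mdist (iter L S P (2 ^+ L * i)) (P i))%:E <= C%:E * delta P)%E.
Proof.
by move=> CS /CS; apply: le_trans; apply: ereal_sup_ubound; exists i.
Qed.

Context (S : nat -> (int -> Omega) -> (int -> Omega))
  (D : nat -> set (int -> Omega)) (L : nat -> nat) (C : nat -> R).
Context (hS : nonstationary_scheme S D L C).

Lemma common_domain_iter k P :
  common_domain D P -> common_domain D (iter (L k) (S k) P).
Proof.
(* Invariance is only assumed for m >= 1; a block of level 0 is the identity. *)
move=> DP; have [->//|Lk] := posnP (L k).
by apply: (scheme_invariant hS (j := k) (m := L k));
  [rewrite Lk leqnn|exists P].
Qed.

Lemma common_domain_refined P k :
  common_domain D P -> common_domain D (refined S L P k).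
Proof. by move=> DP; elim: k => [|k IH]; apply: common_domain_iter. Qed.

Lemma common_domain_delta P : common_domain D P -> (delta P < +oo)%E.
Proof.
by move=> DP; apply: (admissible_domain (scheme_admissible hS 0)); exact: DP.
Qed.

Context (hconst : forall j P, common_domain D P ->
  delta P = 0%E -> delta (iter (L j) (S j) P) = 0%E).

Lemma delta_block_le k P : common_domain D P ->
  (delta (iter (L k) (S k) P)
    <= refinement_factor (S k) (D k) (L k) * delta P)%E.
Proof.
by move=> DP; apply: delta_iter_le;
  [exact: DP|exact: common_domain_delta|exact: hconst].
Qed.

Lemma delta_refined_le P k : common_domain D P ->
  (delta (refined S L P k)
    <= (\prod_(0 <= j < k.+1) refinement_factor (S j) (D j) (L j)) * delta P)%E.
Proof.
move=> DP; elim: k => [|k IH]; first by rewrite big_nat1; exact: delta_block_le.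
rewrite big_nat_recr//= [X in (X * _)%E]muleC -muleA.
have := delta_block_le k.+1 (common_domain_refined k DP).
move=> /le_trans; apply.
by rewrite lee_wpmul2l// refinement_factor_ge0.
Qed.

Lemma cvg_series_delta_refined P : common_domain D P ->
  (\sum_(0 <= k <oo)
     \prod_(0 <= j < k.+1) refinement_factor (S j) (D j) (L j) < +oo)%E ->
  cvgn (series (fun k => fine (delta (refined S L P k)))).
Proof.
move=> DP sfin.
have prod_ge0 k :
    (0 <= \prod_(0 <= j < k.+1) refinement_factor (S j) (D j) (L j))%E.
  by apply: prode_ge0 => j _; exact: refinement_factor_ge0.
have dfin Q : common_domain D Q -> delta Q \is a fin_num.
  by move=> /common_domain_delta/delta_fin_num.
set M := (\sum_(0 <= k <oo) _)%E in sfin.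
have Mfin : M \is a fin_num by rewrite ge0_fin_numE//; exact: nneseries_ge0.
apply: nondecreasing_is_cvgn.
  by apply: nondecreasing_series => k _ _; rewrite fine_ge0// delta_ge0.
exists (fine M * fine (delta P)) => _ [n _ <-].
rewrite -lee_fin EFinM !fineK ?dfin// /series/= -sumEFin.
apply: le_trans (lee_wpmul2r (delta_ge0 P)
  (nneseries_lim_ge n (fun k _ _ => prod_ge0 k))).
rewrite ge0_sume_distrl//; apply: lee_sum => k _.
rewrite fineK; last exact/dfin/common_domain_refined.
exact: delta_refined_le.
Qed.

End Variation.

(** * Convergence of the scheme *)

Theorem theorem7p3 (R : realType) (Omega : completeMetricType R)
  (A : R -> Omega -> Omega -> Omega) (hA : is_average A)
  (S : nat -> (int -> Omega) -> (int -> Omega))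
  (D : nat -> set (int -> Omega)) (L : nat -> nat) (C : nat -> R)
  (hS : nonstationary_scheme S D L C)
  (* a block does not create variation out of a constant sequence; the
     refinement factor only constrains sequences with delta P > 0 *)
  (hconst : forall j P, common_domain D P ->
     delta P = 0%E -> delta (iter (L j) (S j) P) = 0%E)
  (hbound : exists (Lstar : nat) (Cstar mustar : R),
     0 <= Cstar /\ 0 <= mustar /\
     forall j, [/\ (L j <= Lstar)%N, C j <= Cstar &
       (refinement_factor (S j) (D j) (L j) <= mustar%:E)%E])
  (hsum : (\sum_(0 <= k <oo)
     \prod_(0 <= j < k.+1) refinement_factor (S j) (D j) (L j) < +oo)%E)
  (P0 : int -> Omega) (hP0 : common_domain D P0) :
  exists Qinf : R -> Omega, continuous Qinf /\
    {uniform, (fun k : nat => piecewise_average A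
                 (@primal_grid R (\sum_(0 <= nu < k.+1) L nu)%N)
                 (refined S L P0 k)) @ \oo --> Qinf}.
Proof.
have [Lstar [Cstar [mustar [Cstar0 [mustar0 bounds]]]]] := hbound.
set F := fun k : nat => piecewise_average A _ _.
pose d k : R := fine (delta (refined S L P0 k)).
have DP k : common_domain D (refined S L P0 k).
  exact: (common_domain_refined hS k hP0).
have dE k : (d k)%:E = delta (refined S L P0 k).
  by rewrite fineK// delta_fin_num// (common_domain_delta hS (DP k)).
have d_ge0 k : 0 <= d k by rewrite -lee_fin dE delta_ge0.
have d_step k j :
    mdist (refined S L P0 k j) (refined S L P0 k (j + 1)) <= d k.
  by rewrite -lee_fin dE mdist_le_delta.
have d_rec k : d k.+1 <= mustar * d k.
  rewrite -lee_fin EFinM !dE.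
  apply: le_trans (delta_block_le hS hconst k.+1 (DP k)) _.
  by rewrite lee_wpmul2r ?delta_ge0//; have [] := bounds k.+1.
have d_disp k i : mdist (refined S L P0 k.+1 (2 ^+ L k.+1 * i))
    (refined S L P0 k i) <= Cstar * d k.
  have DPk : D k.+1 (refined S L P0 k) by exact: DP.
  rewrite -lee_fin EFinM dE.
  have := displacement_safe_mdist i (scheme_displacement hS (j := k.+1)) DPk.
  move=> /le_trans; apply.
  by rewrite lee_wpmul2r ?delta_ge0// lee_fin; have [] := bounds k.+1.
pose K : R := 1 + Cstar + 2 ^+ Lstar * mustar.
have F_step k s : mdist (F k s) (F k.+1 s) <= K * d k.
  rewrite /F (big_nat_recr k.+1)//=.
  have := mdist_piecewise_average_refine hA (\sum_(0 <= nu < k.+1) L nu) s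
    (d_step k) (d_step k.+1) (d_disp k).
  move=> /le_trans; apply.
  rewrite !mulrDl mul1r lerD2l -mulrA ler_pM ?exprn_ge0//.
  by rewrite ler_weXn2l ?ler1n//; have [] := bounds k.+1.
have [|Qinf FQ] := uniform_cvg_summable_steps F_step.
  exact: (is_cvg_seriesZ (k := K)
    (cvg_series_delta_refined hS hconst hP0 hsum)).
exists Qinf; split=> //.
have F_continuous k : continuous (F k).
  apply: piecewise_average_continuous => //; last exact: primal_grid_cell.
  by move=> i j; rewrite ltr_primal_grid.
apply: (@uniform_limit_continuous R Omega (F @ \oo) Qinf _ _ FQ).
by exists 0%N => // k _; exact: F_continuous.
Qed.
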